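(* Let $D$ be $\mathbb O$ or $\mathbb H$, and let $f(x)=x^2+Bx+C$ with $B,C\in D$ be a monic quadratic polynomial with a pseudo-periodic point $\alpha\in D$ of order $n$. For $i\in\{0,1,\dots,n-1\}$ put $\alpha_i=f^{*i}(\alpha)$ and $$M_i=\Re(2\alpha_i+B)^2+\big(|\Im(\alpha_i+B)|+|\Im(\alpha_i)|\big)^2.$$ If $\prod_{i=0}^{n-1}M_i<1$, then $\alpha$ is attracting.
   Context: $\mathbb H$ is Hamilton's real quaternion algebra and $\mathbb O=\mathbb H\oplus\mathbb H\ell$ is the real octonion division algebra, with multiplication $(q+r\ell)(s+t\ell)=qs-\overline{t}r+(tq+r\overline{s})\ell$ and involution $\overline{q+r\ell}=\overline q-r\ell$. For $z$ in $\mathbb H$ or $\mathbb O$: $\Re(z)=\tfrac12(z+\overline z)\in\mathbb R$, $\Im(z)=z-\Re(z)$, $|z|=\sqrt{z\overline z}$ (the Euclidean norm). Polynomials over $D$ are elements of $D[x]=D\otimes_{\mathbb R}\mathbb R[x]$ ($x$ central). Substitution of $\lambda\in D$ in $f(x)=x^2+Bx+C$ is $f(\lambda)=\lambda^2+B\lambda+C$. The iterates of substitution are $f^{*0}(\lambda)=\lambda$, $f^{*1}(\lambda)=f(\lambda)$ and $f^{*n}(\lambda)=f(f^{*(n-1)}(\lambda))$. A point $\alpha\in D$ is a pseudo-periodic point of $f$ if $f^{*n}(\alpha)=\alpha$ for some integer $n\ge1$; the minimal such $n$ is its order. A neighborhood of $\alpha$ is a set containing an open ball centered at $\alpha$. A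 pseudo-periodic point $\alpha$ of order $n$ is attracting if there exist a positive real constant $c<1$ and a neighborhood $S$ of $\alpha$ such that $|f^{*n}(\lambda)-\alpha|<c\,|\lambda-\alpha|$ for every $\lambda\in S\setminus\{\alpha\}$. *)

(* Defs.v *)
From HB Require Import structures.
From mathcomp Require Import all_boot all_order all_algebra.
From mathcomp Require Import ring lra.
From mathcomp Require Import classical_sets reals.

Set Implicit Arguments.
Unset Strict Implicit.
Unset Printing Implicit Defensive.

Import Order.TTheory GRing.Theory Num.Theory.
Local Open Scope ring_scope.

(** Hamilton's quaternions: [Quat a b c d] is a + b i + c j + d k. *)

Record quaternion (R : Type) := Quat { q1 : R; qi : R; qj : R; qk : R }.

Definition tuple_of_quat R (q : quaternion R) := (q1 q, qi q, qj q, qk q).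
Definition quat_of_tuple R (t : R * R * R * R) :=
  Quat t.1.1.1 t.1.1.2 t.1.2 t.2.

Lemma tuple_of_quatK R : cancel (@tuple_of_quat R) (@quat_of_tuple R).
Proof. by case. Qed.

HB.instance Definition _ (R : choiceType) :=
  Choice.copy (quaternion R) (can_type (@tuple_of_quatK R)).

Section Quaternion.
Variable R : realType.
Implicit Types (a : R) (p q r : quaternion R).

Definition addq p q :=
  Quat (q1 p + q1 q) (qi p + qi q) (qj p + qj q) (qk p + qk q).
Definition oppq q := Quat (- q1 q) (- qi q) (- qj q) (- qk q).
Definition scaleq a q := Quat (a * q1 q) (a * qi q) (a * qj q) (a * qk q).
Definition mulq p q :=
  Quat (q1 p * q1 q - qi p * qi q - qj p * qj q - qk p * qk q)
       (q1 p * qi q + qi p * q1 q + qj p * qk q - qk p * qj q)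
       (q1 p * qj q - qi p * qk q + qj p * q1 q + qk p * qi q)
       (q1 p * qk q + qi p * qj q - qj p * qi q + qk p * q1 q).
Definition conjq q := Quat (q1 q) (- qi q) (- qj q) (- qk q).

Fact addqA : associative addq.
Proof. by move=> p q r; rewrite /addq /= !addrA. Qed.
Fact addqC : commutative addq.
Proof. by move=> p q; rewrite /addq; congr Quat; apply: addrC. Qed.
Fact add0q : left_id (Quat 0 0 0 0) addq.
Proof. by case=> *; rewrite /addq /= !add0r. Qed.
Fact addNq : left_inverse (Quat 0 0 0 0) oppq addq.
Proof. by move=> q; rewrite /addq /= !addNr. Qed.

HB.instance Definition _ :=
  GRing.isZmodule.Build (quaternion R) addqA addqC add0q addNq.

Fact mulqA : associative mulq.
Proof. by move=> p q r; rewrite /mulq /=; congr Quat; ring. Qed.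
Fact mul1q : left_id (Quat 1 0 0 0) mulq.
Proof. by case=> *; rewrite /mulq /=; congr Quat; ring. Qed.
Fact mulq1 : right_id (Quat 1 0 0 0) mulq.
Proof. by case=> *; rewrite /mulq /=; congr Quat; ring. Qed.
Fact mulqDl : left_distributive mulq +%R.
Proof. by move=> p q r; congr Quat => /=; ring. Qed.
Fact mulqDr : right_distributive mulq +%R.
Proof. by move=> p q r; congr Quat => /=; ring. Qed.
Fact oneq_neq0 : Quat 1 0 0 0 != 0 :> quaternion R.
Proof. by apply/eqP; case=> /eqP; rewrite oner_eq0. Qed.

HB.instance Definition _ := GRing.Zmodule_isNzRing.Build (quaternion R)
  mulqA mul1q mulq1 mulqDl mulqDr oneq_neq0.

Fact scaleqA a b q : scaleq a (scaleq b q) = scaleq (a * b) q.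
Proof. by rewrite /scaleq /= !mulrA. Qed.
Fact scale1q : left_id 1 scaleq.
Proof. by case=> *; rewrite /scaleq /= !mul1r. Qed.
Fact scaleqDr : right_distributive scaleq +%R.
Proof. by move=> a p q; congr Quat => /=; rewrite mulrDr. Qed.
Fact scaleqDl q : {morph scaleq^~ q : a b / a + b}.
Proof. by move=> a b; congr Quat => /=; rewrite mulrDl. Qed.

HB.instance Definition _ := GRing.Zmodule_isLmodule.Build R (quaternion R)
  scaleqA scale1q scaleqDr scaleqDl.

End Quaternion.

(** Octonions: [Oct q r] is q + r l. *)

Record octonion (R : Type) := Oct { oq : quaternion R; ol : quaternion R }.

Definition pair_of_oct R (z : octonion R) := (oq z, ol z).
Definition oct_of_pair R (t : quaternion R * quaternion R) := Oct t.1 t.2.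

Lemma pair_of_octK R : cancel (@pair_of_oct R) (@oct_of_pair R).
Proof. by case. Qed.

HB.instance Definition _ (R : choiceType) :=
  Choice.copy (octonion R) (can_type (@pair_of_octK R)).

Section Octonion.
Variable R : realType.
Implicit Types (a : R) (x y z : octonion R).

Definition addo x y := Oct (oq x + oq y) (ol x + ol y).
Definition oppo x := Oct (- oq x) (- ol x).
Definition scaleo a x := Oct (a *: oq x) (a *: ol x).
Definition oneo : octonion R := Oct 1 0.
Definition mulo x y :=
  Oct (oq x * oq y - conjq (ol y) * ol x) (ol y * oq x + ol x * conjq (oq y)).
Definition conjo x := Oct (conjq (oq x)) (- ol x).

Fact addoA : associative addo.
Proof. by move=> x y z; rewrite /addo /= !addrA. Qed.
Fact addoC : commutative addo.
Proof. by move=> x y; rewrite /addo; congr Oct; apply: addrC. Qed.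
Fact add0o : left_id (Oct 0 0) addo.
Proof. by case=> *; rewrite /addo /= !add0r. Qed.
Fact addNo : left_inverse (Oct 0 0) oppo addo.
Proof. by move=> x; rewrite /addo /= !addNr. Qed.

HB.instance Definition _ :=
  GRing.isZmodule.Build (octonion R) addoA addoC add0o addNo.

Fact scaleoA a b x : scaleo a (scaleo b x) = scaleo (a * b) x.
Proof. by rewrite /scaleo /= !scalerA. Qed.
Fact scale1o : left_id 1 scaleo.
Proof. by case=> *; rewrite /scaleo /= !scale1r. Qed.
Fact scaleoDr : right_distributive scaleo +%R.
Proof. by move=> a x y; congr Oct => /=; rewrite scalerDr. Qed.
Fact scaleoDl x : {morph scaleo^~ x : a b / a + b}.
Proof. by move=> a b; congr Oct => /=; rewrite scalerDl. Qed.

HB.instance Definition _ := GRing.Zmodule_isLmodule.Build R (octonion R)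
  scaleoA scale1o scaleoDr scaleoDl.

End Octonion.

(** A bare signature shared by the two algebras, with no axioms; the only
    instances of interest are [quatAlg] and [octAlg].  The octonions are not
    associative, so the product cannot be MathComp's ring product.
    [iacoord] is the coordinate of an element along the unit: it reads off the
    real number a from a *: iaone. *)

Record involAlg (R : realType) := InvolAlg {
  iasort :> lmodType R;
  iaone : iasort;
  iamul : iasort -> iasort -> iasort;
  iaconj : iasort -> iasort;
  iacoord : iasort -> R }.

Arguments iaone {R i}.
Arguments iamul {R i}.
Arguments iaconj {R i}.
Arguments iacoord {R i}.

Notation "x ** y" := (iamul x y) (at level 40, left associativity) : ring_scope.

Definition quatAlg (R : realType) : involAlg R :=
  @InvolAlg R (quaternion R) 1 *%R (@conjq R) (@q1 R).

Definition octAlg (R : realType) : involAlg R :=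
  @InvolAlg R (octonion R) (@oneo R) (@mulo R) (@conjo R)
    (fun z => q1 (oq z)).

Section InvolAlg.
Variables (R : realType) (D : involAlg R).
Implicit Types z : D.

Definition Re z : R := iacoord (2^-1 *: (z + iaconj z)).
Definition Im z : D := z - Re z *: iaone.
Definition absD z : R := Num.sqrt (iacoord (z ** iaconj z)).

End InvolAlg.

(* z + conj z and z ** conj z are real, so [iacoord] loses nothing above. *)
Lemma Re_quat (R : realType) (z : quatAlg R) :
  Re z *: iaone = 2^-1 *: (z + iaconj z).
Proof. by case: z => a b c d; congr Quat => /=; rewrite ?subrr ?mulr0 ?mulr1. Qed.

Lemma Re_oct (R : realType) (z : octAlg R) :
  Re z *: iaone = 2^-1 *: (z + iaconj z).
Proof.
case: z => [[a b c d] [e f g h]]; congr Oct; congr Quat => /=;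
  by rewrite ?subrr ?mulr0 ?mulr1.
Qed.

Lemma mulD_conj_quat (R : realType) (z : quatAlg R) :
  z ** iaconj z = (q1 z ^+ 2 + qi z ^+ 2 + qj z ^+ 2 + qk z ^+ 2) *: iaone.
Proof. by case: z => a b c d; congr Quat => /=; ring. Qed.

Lemma mulD_conj_oct (R : realType) (z : octAlg R) :
  z ** iaconj z =
  (q1 (oq z) ^+ 2 + qi (oq z) ^+ 2 + qj (oq z) ^+ 2 + qk (oq z) ^+ 2 +
   q1 (ol z) ^+ 2 + qi (ol z) ^+ 2 + qj (ol z) ^+ 2 + qk (ol z) ^+ 2)
  *: iaone.
Proof.
by case: z => [[a b c d] [e f g h]]; congr Oct; congr Quat => /=; ring.
Qed.

Section Dynamics.
Variables (R : realType) (D : involAlg R).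
Implicit Types (f : D -> D) (alpha lambda : D) (n : nat).

(* Substitution in the monic quadratic polynomial x^2 + B x + C of D[x]. *)
Definition quad_subst (B C lambda : D) : D := lambda ** lambda + B ** lambda + C.

Definition pseudo_periodic_of_order f alpha n : Prop :=
  [/\ (0 < n)%N, iter n f alpha = alpha &
      forall m, (0 < m)%N -> iter m f alpha = alpha -> (n <= m)%N].

Definition open_ball alpha (r : R) : set D :=
  [set lambda | absD (lambda - alpha) < r]%classic.

Definition neighborhood alpha (S : set D) : Prop :=
  exists2 r : R, 0 < r & (open_ball alpha r `<=` S)%classic.

(* The order is determined by f and alpha, so the existential on n is harmless. *)
Definition attracting f alpha : Prop :=
  exists2 n, pseudo_periodic_of_order f alpha n &
  exists (c : R) (S : set D),
    [/\ 0 < c, c < 1, neighborhood alpha S &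
        forall lambda, (S `\ alpha)%classic lambda ->
          absD (iter n f lambda - alpha) < c * absD (lambda - alpha)].

Definition multiplier_bound (B alpha : D) : R :=
  Re (2 *: alpha + B) ^+ 2 + (absD (Im (alpha + B)) + absD (Im alpha)) ^+ 2.

End Dynamics.

(* Main.v *)
Require Import Defs.
From mathcomp Require Import all_boot all_order all_algebra.
From mathcomp Require Import classical_sets reals.
From mathcomp Require Import ring lra.
Import Order.TTheory GRing.Theory Num.Theory.
Local Open Scope ring_scope.

(* [Num.Theory] shadows both names. *)
Local Notation Re := Defs.Re.
Local Notation Im := Defs.Im.

(** Writing [lambda = a + h], one has [f(a + h) - f(a) = h h + L h] with
    [L h = (a + B) h + h a = r h + (u h + h v)], where [r = Re(2a + B)],
    [u = Im(a + B)] and [v = Im(a)].  Since [u] and [v] are purely imaginary,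
    [u h] and [h v] are orthogonal to [h], so by Pythagoras and
    multiplicativity of the norm [|L h|^2 <= M |h|^2].  Hence one step of [f]
    stretches the distance to [a] by at most [sqrt M + |h|], and the estimates
    multiply along the orbit up to an error that is again [O(|h|)]. *)

Section OctonionNorm.
Variable R : realType.
Implicit Types x y z h : octAlg R.

(** The Euclidean inner product of [R^8], obtained by polarizing [z ** iaconj z]. *)
Definition doto x y : R := iacoord (x ** iaconj y).

Lemma absDE z : absD z = Num.sqrt (doto z z).
Proof. by []. Qed.

Lemma Re_octE z : Re z = q1 (oq z).
Proof. by case: z => [[a b c d] q]; rewrite /Defs.Re /=; field. Qed.

Lemma dotoC x y : doto x y = doto y x.
Proof.
by case: x y => [[? ? ? ?] [? ? ? ?]] [[? ? ? ?] [? ? ? ?]]; rewrite /doto /=; ring.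
Qed.

Lemma dotoDl x y z : doto (x + y) z = doto x z + doto y z.
Proof.
by case: x y z => [[? ? ? ?] [? ? ? ?]] [[? ? ? ?] [? ? ? ?]]
  [[? ? ? ?] [? ? ? ?]]; rewrite /doto /=; ring.
Qed.

Lemma dotoDr x y z : doto x (y + z) = doto x y + doto x z.
Proof. by rewrite dotoC dotoDl !(dotoC x). Qed.

Lemma dotoZl (a : R) x y : doto (a *: x) y = a * doto x y.
Proof.
by case: x y => [[? ? ? ?] [? ? ? ?]] [[? ? ? ?] [? ? ? ?]]; rewrite /doto /=; ring.
Qed.

Lemma dotoZr (a : R) x y : doto x (a *: y) = a * doto x y.
Proof. by rewrite dotoC dotoZl dotoC. Qed.

Lemma dotoE z : doto z z =
  q1 (oq z) ^+ 2 + qi (oq z) ^+ 2 + qj (oq z) ^+ 2 + qk (oq z) ^+ 2 +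
  q1 (ol z) ^+ 2 + qi (ol z) ^+ 2 + qj (ol z) ^+ 2 + qk (ol z) ^+ 2.
Proof. by rewrite /doto mulD_conj_oct /= mulr1. Qed.

Lemma doto_ge0 z : 0 <= doto z z.
Proof. by rewrite dotoE !addr_ge0 ?sqr_ge0. Qed.

Lemma doto_eq0 z : doto z z = 0 -> z = 0.
Proof.
move/eqP; rewrite dotoE !paddr_eq0 ?addr_ge0 ?sqr_ge0 // !sqrf_eq0.
by case: z => [[a b c d] [e f g h]] /=; do 7![case/andP]; do 8!move/eqP->.
Qed.

(** Degen's eight-square identity, checked in coordinates. *)
Lemma doto_mul x y : doto (x ** y) (x ** y) = doto x x * doto y y.
Proof.
rewrite !dotoE; case: x y => [[? ? ? ?] [? ? ? ?]] [[? ? ? ?] [? ? ? ?]] /=; ring.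
Qed.

(** Multiplication by [z] is [Re z] times the identity plus a skew-symmetric map, so an imaginary
    [z] sends [h] to a vector orthogonal to [h]. The same holds on the right. *)
Lemma doto_mull h z : doto h (z ** h) = Re z * doto h h.
Proof.
rewrite Re_octE dotoE /doto.
by case: h z => [[? ? ? ?] [? ? ? ?]] [[? ? ? ?] [? ? ? ?]] /=; ring.
Qed.

Lemma doto_mulr h z : doto h (h ** z) = Re z * doto h h.
Proof.
rewrite Re_octE dotoE /doto.
by case: h z => [[? ? ? ?] [? ? ? ?]] [[? ? ? ?] [? ? ? ?]] /=; ring.
Qed.

Lemma Re_Im z : Re (Im z) = 0.
Proof. by rewrite Re_octE /Defs.Im Re_octE /= mulr1 subrr. Qed.

Lemma absD_sqr z : absD z ^+ 2 = doto z z.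
Proof. by rewrite sqr_sqrtr // doto_ge0. Qed.

Lemma absD_mul x y : absD (x ** y) = absD x * absD y.
Proof. by rewrite !absDE doto_mul sqrtrM // doto_ge0. Qed.

Lemma absD_oct_gt0 z : z != 0 -> 0 < absD z.
Proof.
rewrite absDE sqrtr_gt0 lt0r doto_ge0 andbT.
by apply: contraNneq => /doto_eq0 ->.
Qed.

Lemma doto_CauchySchwarz x y : doto x y <= absD x * absD y.
Proof.
have [->|y0] := eqVneq y 0.
  have -> : doto x 0 = 0 by rewrite -(scale0r (0 : octAlg R)) dotoZr mul0r.
  by rewrite mulr_ge0 ?sqrtr_ge0.
have yy0 : 0 < doto y y by rewrite -sqrtr_gt0 -absDE absD_oct_gt0.
rewrite -sqrtrM ?doto_ge0 //; apply: le_trans (ler_norm _) _.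
rewrite -sqrtr_sqr ler_wsqrtr // -/(doto x x) -/(doto y y).
(* With [X], [Y], [P] as named below, the squared norm of [Y x - P y] is [Y * (X * Y - P ^+ 2)], and
   [Y] is positive. *)
have := doto_ge0 (doto y y *: x + (- doto x y) *: y).
rewrite !(dotoDl, dotoDr, dotoZl, dotoZr) (dotoC y x).
set X := doto x x; set Y := doto y y; set P := doto x y.
rewrite (_ : _ + _ = Y * (X * Y - P ^+ 2)); last ring.
by rewrite pmulr_rge0 // subr_ge0.
Qed.

Lemma absD_triangle x y : absD (x + y) <= absD x + absD y.
Proof.
rewrite -(ler_pXn2r (n := 2)) // ?nnegrE ?addr_ge0 ?sqrtr_ge0 //.
rewrite sqrrD !absD_sqr !(dotoDl, dotoDr) (dotoC y x).
have := doto_CauchySchwarz x y; lra.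
Qed.

Lemma absD_differential B a h :
  absD (Re (2 *: a + B) *: h + (Im (a + B) ** h + h ** Im a)) <=
  Num.sqrt (multiplier_bound B a) * absD h.
Proof.
rewrite absDE -sqrtrM; last by rewrite addr_ge0 ?sqr_ge0.
rewrite ler_wsqrtr // -/(doto h h).
set r := Re _; set w := _ ** h + _.
have hw : doto h w = 0 by rewrite dotoDr doto_mull doto_mulr !Re_Im !mul0r addr0.
have wle : absD w <= (absD (Im (a + B)) + absD (Im a)) * absD h.
  by rewrite (le_trans (absD_triangle _ _)) // !absD_mul mulrDl (mulrC (absD h)).
(* Only [hw] and [wle] matter from here; an opaque [w] keeps the bilinear expansion from splitting
   it. *)
clearbody w.
rewrite !(dotoDl, dotoDr, dotoZl, dotoZr) (dotoC w h) hw mulr0 addr0 add0r.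
rewrite mulrDl mulrA -expr2 lerD2l -(absD_sqr w) -(absD_sqr h) -exprMn.
by rewrite ler_pXn2r // ?nnegrE ?mulr_ge0 ?addr_ge0 ?sqrtr_ge0.
Qed.

(** The real parts of [a + B] and of [a] act as scalars on either side of [h], so they merge into
    [Re (2 *: a + B)]. *)
Lemma quad_subst_differential B C a h :
  quad_subst B C (a + h) - quad_subst B C a =
  h ** h + (Re (2 *: a + B) *: h + (Im (a + B) ** h + h ** Im a)).
Proof.
rewrite /quad_subst /Defs.Im !Re_octE.
case: a B C h => [[? ? ? ?] [? ? ? ?]] [[? ? ? ?] [? ? ? ?]]
  [[? ? ? ?] [? ? ? ?]] [[? ? ? ?] [? ? ? ?]].
by congr Oct; congr Quat => /=; ring.
Qed.

Lemma quad_subst_dist_oct (B C a x : octAlg R) :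
  absD (quad_subst B C x - quad_subst B C a) <=
  (Num.sqrt (multiplier_bound B a) + absD (x - a)) * absD (x - a).
Proof.
have {1}-> : x = a + (x - a) by rewrite addrC subrK.
rewrite quad_subst_differential (le_trans (absD_triangle _ _)) //.
by rewrite absD_mul mulrDl addrC lerD2r absD_differential.
Qed.

End OctonionNorm.

Section QuaternionEmbedding.
Variable R : realType.
Implicit Types x y z : quatAlg R.

(** The subalgebra of octonions without [l]-part. The embedding respects products, norms, [Re] and
    [Im], so the octonion estimate restricts to quaternions. *)
Definition oct_of_quat z : octAlg R := Oct z 0.

Lemma oct_of_quatD x y : oct_of_quat (x + y) = oct_of_quat x + oct_of_quat y.
Proof. by congr Oct; rewrite addr0. Qed.

Lemma oct_of_quatB x y : oct_of_quat (x - y) = oct_of_quat x - oct_of_quat y.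
Proof. by congr Oct; rewrite subr0. Qed.

Lemma oct_of_quatZ (a : R) x : oct_of_quat (a *: x) = a *: oct_of_quat x.
Proof. by congr Oct; rewrite scaler0. Qed.

Lemma oct_of_quatM x y : oct_of_quat (x ** y) = oct_of_quat x ** oct_of_quat y.
Proof. by congr Oct; rewrite /= ?mulr0 ?mul0r ?subr0 ?addr0. Qed.

Lemma absD_oct_of_quat z : absD (oct_of_quat z) = absD z.
Proof. by rewrite /absD mulD_conj_oct mulD_conj_quat /= !expr0n !addr0. Qed.

Lemma Re_oct_of_quat z : Re (oct_of_quat z) = Re z.
Proof. by []. Qed.

Lemma Im_oct_of_quat z : Im (oct_of_quat z) = oct_of_quat (Im z).
Proof. by rewrite /Defs.Im oct_of_quatB oct_of_quatZ. Qed.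

Lemma quad_subst_oct_of_quat B C z :
  quad_subst (oct_of_quat B) (oct_of_quat C) (oct_of_quat z) =
  oct_of_quat (quad_subst B C z).
Proof. by rewrite /quad_subst !oct_of_quatD !oct_of_quatM. Qed.

Lemma multiplier_bound_oct_of_quat B z :
  multiplier_bound (oct_of_quat B) (oct_of_quat z) = multiplier_bound B z.
Proof.
rewrite /multiplier_bound -oct_of_quatZ -!oct_of_quatD Re_oct_of_quat.
by rewrite !Im_oct_of_quat !absD_oct_of_quat.
Qed.

Lemma absD_quat_gt0 z : z != 0 -> 0 < absD z.
Proof.
move=> z0; rewrite -absD_oct_of_quat absD_oct_gt0 //.
by apply: contraNneq z0 => -[->].
Qed.

Lemma quad_subst_dist_quat (B C a x : quatAlg R) :
  absD (quad_subst B C x - quad_subst B C a) <=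
  (Num.sqrt (multiplier_bound B a) + absD (x - a)) * absD (x - a).
Proof.
have := quad_subst_dist_oct R (oct_of_quat B) (oct_of_quat C)
  (oct_of_quat a) (oct_of_quat x).
by rewrite !quad_subst_oct_of_quat multiplier_bound_oct_of_quat
  -!oct_of_quatB !absD_oct_of_quat.
Qed.

End QuaternionEmbedding.

(** Induction on [n]: the one-step factors multiply, and the restriction to the unit ball lets [K]
    absorb all terms of higher order in the distance. *)
Lemma iter_dist_bound (R : realType) (D : involAlg R) (f : D -> D) (m : D -> R)
    (alpha : D) :
  (forall a, 0 <= m a) ->
  (forall a x, absD (f x - f a) <= (m a + absD (x - a)) * absD (x - a)) ->
  forall n, exists2 K : R, 0 <= K & forall x, absD (x - alpha) <= 1 ->
    absD (iter n f x - iter n f alpha) <=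
    (\prod_(0 <= i < n) m (iter i f alpha) + K * absD (x - alpha)) *
    absD (x - alpha).
Proof.
move=> m_ge0 f_dist; elim=> [|n [K K0 IH]].
  by exists 0 => // x _; rewrite big_geq // mul0r addr0 mul1r.
rewrite big_nat_recr //=; set p := \prod_(0 <= i < n) _ in IH *.
have p0 : 0 <= p by rewrite prodr_ge0.
set s := m _; have s0 : 0 <= s by exact: m_ge0.
(* With [d <= (p + K * e) * e], expanding [(s + d) * d] gives [s * p * e], then [s * K * e ^+ 2],
   and a term at most [(p + K) ^+ 2 * e ^+ 2] because [e <= 1]. *)
exists (s * K + (p + K) ^+ 2) => [|x x1].
  by rewrite addr_ge0 ?sqr_ge0 ?mulr_ge0.
apply: le_trans (f_dist _ _) _; move: (IH x x1); rewrite -/s.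
set d := absD (iter n f x - _); set e := absD (x - alpha) in x1 *.
have d0 : 0 <= d by exact: sqrtr_ge0.
have e0 : 0 <= e by exact: sqrtr_ge0.
move=> de.
have pKe : p + K * e <= p + K by rewrite lerD2l ler_piMr.
have de' : d <= (p + K) * e by apply: le_trans de _; rewrite ler_wpM2r.
apply: le_trans (_ : (s + (p + K) * e) * ((p + K * e) * e) <= _).
  by rewrite ler_pM ?addr_ge0 // lerD2l.
rewrite mulrA ler_wpM2r // mulrDl.
have -> : p * s + (s * K + (p + K) ^+ 2) * e =
  s * (p + K * e) + (p + K) * e * (p + K) by ring.
by rewrite lerD2l ler_wpM2l // mulr_ge0 ?addr_ge0.
Qed.

Lemma attracting_of_dist (R : realType) (D : involAlg R) (f : D -> D)
    (m : D -> R) (alpha : D) (n : nat) :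
  (forall z : D, z != 0 -> 0 < absD z) ->
  (forall a, 0 <= m a) ->
  (forall a x, absD (f x - f a) <= (m a + absD (x - a)) * absD (x - a)) ->
  pseudo_periodic_of_order f alpha n ->
  \prod_(0 <= i < n) m (iter i f alpha) < 1 ->
  attracting f alpha.
Proof.
move=> abs_gt0 m_ge0 f_dist per.
have [_ fix_alpha _] := per.
have [K K0] := iter_dist_bound R D f m alpha m_ge0 f_dist n.
rewrite fix_alpha; set p := \prod_(0 <= i < n) _ => H p1.
have p0 : 0 <= p by rewrite prodr_ge0.
have K1 : 0 < K + 1 by lra.
(* The constant is the midpoint of [p] and 1. The radius is at most 1 for the orbit estimate, and
   small enough that [K * e < (1 - p) / 2]; dividing by [K + 1] covers [K = 0]. *)
exists n => //; exists ((1 + p) / 2).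
exists (open_ball alpha (Num.min 1 ((1 - p) / 2 / (K + 1)))).
split; [lra|lra| |].
  by eexists; last exact: subset_refl; rewrite lt_min ltr01 divr_gt0 //; lra.
move=> x [] /=; rewrite /open_ball /= lt_min ltr_pdivlMr // => /andP[x1 xK] xa.
have e0 : 0 < absD (x - alpha) by rewrite abs_gt0 // subr_eq0; apply/eqP.
apply: le_lt_trans (H x (ltW x1)) _; rewrite ltr_pM2r //.
move: xK; rewrite mulrDr mulr1 mulrC; lra.
Qed.

Theorem theorem6p1 (R : realType) (D : involAlg R)
    (hD : D = octAlg R \/ D = quatAlg R) (B C alpha : D) (n : nat)
    (halpha : pseudo_periodic_of_order (quad_subst B C) alpha n)
    (hM : \prod_(0 <= i < n)
            multiplier_bound B (iter i (quad_subst B C) alpha) < 1) :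
  attracting (quad_subst B C) alpha.
Proof.
have M_ge0 a : 0 <= multiplier_bound B a by rewrite addr_ge0 ?sqr_ge0.
apply: (attracting_of_dist _ _ _ (fun a => Num.sqrt (multiplier_bound B a)))
  halpha _.
- by case: hD => ->; [exact: absD_oct_gt0|exact: absD_quat_gt0].
- by move=> a; exact: sqrtr_ge0.
- move=> a x; case: hD B C a x {alpha hM M_ge0} => -> B C a x.
    exact: quad_subst_dist_oct.
  exact: quad_subst_dist_quat.
(* The stretching factors are the square roots of the [M_i], so their product is compared with 1
   after squaring. *)
rewrite -(expr_lt1 (n := 2)) //; last by apply: prodr_ge0 => i _; exact: sqrtr_ge0.
by rewrite -GRing.prodrXl; under eq_bigr do rewrite sqr_sqrtr //.
Qed.
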